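(* Let $c<1/2$ be arbitrary and $p\in(0,1)$. Consider $n\ge M$ with $M\to\infty$, and let $\mathcal{M}\in\{0,1\}^{M\times n}$ have i.i.d. Bernoulli$(p)$ entries. Then there exists $M_0\in\mathbb{N}$ such that for every $M,p$ with $(p-p^2)M\ge M_0$ (and every $n\ge M$) there exists no $\bigl(e^{-cM},\sqrt{M(p-p^2)}/24\bigr)$-online algorithm for discrepancy (in the sense defined in the context).
   Context: Let $\Sigma_n=\{-1,1\}^n$. Let $\mathcal{M}\in\mathbb{R}^{M\times n}$ be a random matrix with columns $\mathcal{C}_1,\dots,\mathcal{C}_n$. For $p_s>0$ and $K>0$, an algorithm $\mathcal{A}$ mapping $\mathcal{M}$ to $\boldsymbol{\sigma}_{\rm ALG}=\mathcal{A}(\mathcal{M})\in\Sigma_n$ is $(p_s,K)$-online for discrepancy if: (Success) $\mathbb{P}\bigl[\|\mathcal{M}\boldsymbol{\sigma}_{\rm ALG}\|_\infty\le K\bigr]\ge p_s$, the probability being over $\mathcal{M}$; (Online) there exist deterministic functions $f_1,\dots,f_n$ such that for every $1\le t\le n$, $\boldsymbol{\sigma}_{\rm ALG}(t)=f_t(\mathcal{C}_1,\dots,\mathcal{C}_t)\in\{-1,1\}$. *)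

(* Defs.v *)
From HB Require Import structures.
From mathcomp Require Import all_boot all_order all_algebra.
From mathcomp Require Import all_classical all_reals all_analysis.

Set Implicit Arguments.
Unset Strict Implicit.
Unset Printing Implicit Defensive.

Import Order.TTheory GRing.Theory Num.Theory.
Import numFieldNormedType.Exports.

Local Open Scope classical_set_scope.
Local Open Scope ring_scope.

Definition Sigma (R : realType) (n : nat) : set 'cV[R]_n :=
  [set s | forall t : 'I_n, s t 0 = -1 \/ s t 0 = 1].

Definition mutual_independence (d d' : measure_display) (T : measurableType d)
    (T' : measurableType d') (R : realType) (P : probability T R)
    (I : finType) (X : I -> {RV P >-> T'}) : Prop :=
  forall (J : {set I}) (B : I -> set T'), (forall i, measurable (B i)) ->
    P [set w | forall i, i \in J -> B i (X i w)]
      = (\prod_(i in J) P (X i @^-1` B i))%E.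

Definition iid_bernoulli (d : measure_display) (T : measurableType d)
    (R : realType) (P : probability T R) (m n : nat) (p : R)
    (X : 'I_m * 'I_n -> {RV P >-> bool}) : Prop :=
  (forall ij, distribution P (X ij) = bernoulli_prob p :> (set bool -> \bar R))
  /\ mutual_independence X.

Definition zero_one_matrix (d : measure_display) (T : measurableType d)
    (R : realType) (P : probability T R) (m n : nat)
    (X : 'I_m * 'I_n -> {RV P >-> bool}) (w : T) : 'M[R]_(m, n) :=
  \matrix_(i < m, j < n) (X (i, j) w)%:R.

(* [t] is 0-based, so the columns revealed at step [t] are those of index
   0, ..., t, that is, t.+1 columns. *)
Definition online (R : realType) (m n : nat)
    (A : 'M[R]_(m, n) -> 'cV[R]_n) : Prop :=
  exists f : forall t : 'I_n, ('I_t.+1 -> 'cV[R]_m) -> R,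
    forall (Z : 'M[R]_(m, n)) (t : 'I_n),
      A Z t 0 = f t (fun s : 'I_t.+1 => col (widen_ord (ltn_ord t) s) Z).

(* On matrices, [`| _ |] is the entrywise maximum norm.  No measurability of
   [A] is required: the success event is automatically measurable when [Mx] is
   a 0/1 matrix with measurable entries. *)
Definition online_for_discrepancy (d : measure_display) (T : measurableType d)
    (R : realType) (P : probability T R) (m n : nat) (Mx : T -> 'M[R]_(m, n))
    (ps K : R) (A : 'M[R]_(m, n) -> 'cV[R]_n) : Prop :=
  [/\ forall Z, Sigma (A Z),
      (ps%:E <= P [set w | (`|Mx w *m A (Mx w)| <= K)%R])%E
    & online A].

(* Main.v *)
(* Write n = l + M. The signs of the first l columns are determined by these
   columns, so after conditioning on them a union bound over the 2 ^ M sign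
   patterns of the last M columns gives
     P(success) <= 2 ^ M * Q ^ M,
   where Q bounds the probability that x + \sum_j tau_j X_j lies in [-K, K],
   for deterministic x, signs tau_j and M independent Bernoulli(p) bits X_j.
   Put q = p - p ^+ 2 and s = sqrt (M q). With probability 2 q each X_j is
   replaced by a fair bit, so the sum is a mixture of translates of binomial
   variables Bin(N, 1/2) with N ~ Bin(M, 2 q). Since
     'C(N, i) / 2 ^ N <= 1 / sqrt (N + 1) <= (s / (N + 1) + 1 / s) / 2
   and E[1 / (N + 1)] <= 1 / (2 q M), every atom has mass at most 3 / (4 s), and
   K = s / 24 gives Q <= (s / 12 + 1) * 3 / (4 s) <= 1 / 4 once s >= 10. Hence
   P(success) <= 2 ^ - M < e ^ (- c M), because e ^ (- c) >= 1 - c > 1 / 2. *)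
Require Import Defs.
From HB Require Import structures.
From mathcomp Require Import all_boot all_order all_algebra.
From mathcomp Require Import all_classical all_reals all_analysis.

From mathcomp Require Import zify ring lra.

Set Implicit Arguments.
Unset Strict Implicit.
Unset Printing Implicit Defensive.

Import Order.TTheory GRing.Theory Num.Theory.
Import numFieldNormedType.Exports.

Local Open Scope classical_set_scope.
Local Open Scope ring_scope.

(** * Upper bounds for binomial coefficients *)

Lemma central_bin_sqr_le (k : nat) :
  ('C(k.*2, k) ^ 2 * k.*2.+1 <= 16 ^ k)%N.
Proof.
elim: k => // k IH.
have h1 := mul_bin_diag k.*2.+2 k.
have h2 := mul_bin_diag k.*2.+1 k.
have h3 : 'C(k.*2.+1, k) = 'C(k.*2.+1, k.+1).
  by rewrite -bin_sub; [congr 'C(_, _); lia | lia].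
rewrite doubleS [(16 ^ _)%N]expnS; move: IH h1 h2; rewrite /= h3 -!muln2.
set x := 'C((k * 2).+1, _); set y := 'C((k * 2).+2, _).
set z := 'C((k * 2)%N, _) => IH h1 h2.
(* Consecutive central coefficients have ratio 2 (2k+1) / (k+1); the induction closes because
   (2k+1)(2k+3) <= 4 (k+1)^2. *)
have h : (k.+1 * y = (k * 2).+1 * 2 * z)%N.
  have -> : y = (2 * x)%N by nia.
  by rewrite mulnCA -h2; ring.
rewrite -(@leq_pmul2l (k.+1 ^ 2)) // mulnA -expnMn h.
have : ((2 * k + 1) * (2 * k + 3) * (z ^ 2 * (k * 2).+1)
        <= (2 * k + 1) * (2 * k + 3) * 16 ^ k)%N by rewrite leq_mul2l IH orbT.
have : ((2 * k + 1) * (2 * k + 3) * 16 ^ k <= 4 * k.+1 ^ 2 * 16 ^ k)%N.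
  by rewrite leq_mul2r; apply/orP; right; rewrite -mulnn; nia.
move: (16 ^ k)%N => u; rewrite -!mulnn; nia.
Qed.

Lemma leq_bin_half (n k : nat) : ('C(n, k) <= 'C(n, n./2))%N.
Proof.
have up j : (j <= n./2)%N -> forall i, (i <= j)%N -> ('C(n, i) <= 'C(n, j))%N.
  elim: j => [|j IH] hj i; first by rewrite leqn0 => /eqP ->.
  rewrite leq_eqVlt => /predU1P[-> //|ij].
  apply: leq_trans (IH (ltnW hj) i ij) _.
  rewrite -(@leq_pmul2l j.+1) // mul_bin_left leq_mul2r; apply/orP; right; lia.
case: (leqP k n./2) => [|hk]; first exact: up.
have [hn|hn] := ltnP n k; first by rewrite bin_small.
rewrite -bin_sub //; apply: up => //; lia.
Qed.

(** The middle coefficient is the worst case. An odd row reduces to the next even row, whose middle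
    entry is twice as large. Squaring keeps the bound in [nat]. *)
Lemma bin_sqr_le (n i : nat) : ('C(n, i) ^ 2 * n.+1 <= 4 ^ n)%N.
Proof.
apply: (@leq_trans ('C(n, n./2) ^ 2 * n.+1)).
  by rewrite leq_mul2r leq_exp2r // leq_bin_half.
set k := n./2; have := odd_double_half n; rewrite -/k; clearbody k.
case: (odd n) => /= <-; rewrite ?add0n ?add1n; last first.
  have := central_bin_sqr_le k.
  by rewrite -[(16)%N]/(4 ^ 2)%N -expnM mul2n.
have := central_bin_sqr_le k.+1; rewrite doubleS binS.
have -> : 'C(k.*2.+1, k.+1) = 'C(k.*2.+1, k).
  by rewrite -bin_sub; [congr 'C(_, _); lia | lia].
rewrite -[(16)%N]/(4 ^ 2)%N -expnM mul2n doubleS [(4 ^ _.+2)%N]expnS.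
move: (4 ^ _)%N => u; rewrite -!mulnn; nia.
Qed.

(** * Averages over binomial distributions *)

Section BinomialAverage.
Variable R : realFieldType.

(** Expectation of [f N] for N ~ Bin(m, r). *)
Definition binavg (r : R) (f : nat -> R) (m : nat) : R :=
  \sum_(i < m.+1) 'C(m, i)%:R * r ^+ i * (1 - r) ^+ (m - i) * f i.

Lemma binavg0 r f : binavg r f 0 = f 0%N.
Proof. by rewrite /binavg big_ord1 bin0 !expr0 !mul1r. Qed.

Lemma binavgS r f m :
  binavg r f m.+1 = r * binavg r (fun i => f i.+1) m + (1 - r) * binavg r f m.
Proof.
rewrite /binavg big_ord_recl /= bin0 subn0.
under eq_bigr => i _ do
  rewrite /bump /= add1n subSS binS natrD [_ + _]addrC !mulrDl.
rewrite big_split /= addrCA; congr (_ + _).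
  by rewrite mulr_sumr; apply: eq_bigr => i _; rewrite exprS; ring.
rewrite [in RHS]big_ord_recl /= bin0 subn0 big_ord_recr /= bin_small // !mul0r.
rewrite addr0 mulrDr mulr_sumr; congr (_ + _); first by rewrite exprS; ring.
apply: eq_bigr => i _; rewrite /bump /= add1n -[(m - i)%N in LHS]prednK; last first.
  by rewrite subn_gt0.
by rewrite subnS [(1 - r) ^+ _.+1]exprS; ring.
Qed.

Lemma binavg_cst r c m : binavg r (fun=> c) m = c.
Proof. by elim: m => [|m IH]; rewrite ?binavg0 // binavgS IH; ring. Qed.

Lemma binavg_lin r a b f g m :
  binavg r (fun i => a * f i + b * g i) m = a * binavg r f m + b * binavg r g m.
Proof.
rewrite /binavg !mulr_sumr -big_split; apply: eq_bigr => i _ /=; ring.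
Qed.

(** Since C(m, i) / (i+1) = C(m+1, i+1) / (m+1), the left side is the expansion of (r + (1 -
    r))^(m+1) without its zeroth term. *)
Lemma binavg_inv (r : R) m : 0 <= r <= 1 ->
  (m.+1%:R * r) * binavg r (fun i => i.+1%:R^-1) m <= 1.
Proof.
move=> /andP[r0 r1].
apply: (@le_trans _ _ ((r + (1 - r)) ^+ m.+1)); last first.
  by rewrite addrC subrK expr1n.
rewrite [in leRHS]addrC exprDn big_ord_recl -[X in X <= _]add0r lerD //.
  by rewrite mulrn_wge0 // mulr_ge0 ?exprn_ge0 // subr_ge0.
rewrite /binavg mulr_sumr ler_sum // => i _.
rewrite /= /bump add1n subSS.
have h : m.+1%:R * 'C(m, i)%:R = i.+1%:R * 'C(m.+1, i.+1)%:R :> R.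
  by rewrite -!natrM -mul_bin_diag.
have i0 : i.+1%:R != 0 :> R by rewrite pnatr_eq0.
rewrite -[X in _ <= X]mulr_natr exprS le_eqVlt; apply/orP; left; apply/eqP.
move: i0 h; move: (i.+1%:R) (m.+1%:R) ('C(m, i)%:R) ('C(m.+1, i.+1)%:R : R).
move=> a b u v a0 h.
transitivity (b * u * r * r ^+ i * (1 - r) ^+ (m - i) / a); first by ring.
by rewrite h; field.
Qed.

(** Each fair binomial atom is at most 1 / sqrt (n+1). AM-GM replaces this by an affine function of
    1 / (n+1), which [binavg_inv] can average over n. *)
Lemma binavg_half_le (s : R) (f : nat -> R) n : 0 < s -> (forall i, 0 <= f i) ->
  binavg 2^-1 f n <= (s / n.+1%:R + s^-1) / 2 * \sum_(i < n.+1) f i.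
Proof.
move=> s0 f0; rewrite /binavg mulr_sumr ler_sum // => i _.
rewrite ler_wpM2r //.
have -> : 1 - 2^-1 = 2^-1 :> R by field.
rewrite -mulrA -exprD subnKC; last by rewrite -ltnS.
rewrite exprVn ler_pdivrMr ?exprn_gt0 //.
set t : R := n.+1%:R; have t0 : 0 < t by rewrite ltr0n.
have t1 : 1 <= t by rewrite ler1n.
have hc : ('C(n, i)%:R : R) ^+ 2 * t <= (2 ^+ n) ^+ 2.
  by rewrite -!natrX -natrM ler_nat -expnM [(n * 2)%N]mulnC expnM bin_sqr_le.
set x : R := 'C(n, i)%:R in hc *; set y : R := 2 ^+ n in hc *.
have x0 : 0 <= x by rewrite ler0n.
have y0 : 0 < y by rewrite exprn_gt0.
clearbody t x y.
have -> : (s / t + s^-1) / 2 * y = (s ^+ 2 + t) * y / (2 * s * t).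
  by field; rewrite !gt_eqF.
rewrite ler_pdivlMr ?mulr_gt0 //.
have s20 : 0 < s ^+ 2 by rewrite exprn_gt0.
have st0 : 0 < s * t by rewrite mulr_gt0.
(* After squaring, [hc] applies, and what remains is (s^2 + t)^2 - 4 s^2 t = (s^2 - t)^2 >= 0. *)
rewrite -(@ler_pXn2r _ 2) ?nnegrE //; last 2 first.
- by rewrite -mulrA; do !apply: mulr_ge0 => //; apply: ltW.
- by apply: mulr_ge0; [apply: addr_ge0|]; apply: ltW.
have -> : (x * (2 * s * t)) ^+ 2 = (4 * s ^+ 2 * t) * (x ^+ 2 * t) by ring.
rewrite exprMn; apply: (@le_trans _ _ ((4 * s ^+ 2 * t) * y ^+ 2)).
  by rewrite ler_pM2l // !mulr_gt0.
rewrite ler_pM2r ?exprn_gt0 // -subr_ge0.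
have -> : (s ^+ 2 + t) ^+ 2 - 4 * s ^+ 2 * t = (s ^+ 2 - t) ^+ 2 by ring.
exact: sqr_ge0.
Qed.

Lemma count_translates_le (K x : R) n : 0 <= K ->
  \sum_(i < n) (`|x + i%:R| <= K)%R%:R <= 2 * K + 1.
Proof.
move=> K0.
(* Bound strengthened for induction on n: the counted points are spaced by 1 between -K and the
   smaller of K and the last point; the maximum with 0 covers an empty count. *)
suff : \sum_(i < n) (`|x + i%:R| <= K)%R%:R
         <= Num.max 0 (Num.min K (x + n%:R - 1) + K + 1).
  move=> h; apply: le_trans h _; rewrite ge_max; apply/andP; split; first lra.
  have : Num.min K (x + n%:R - 1) <= K by rewrite ge_min lexx.
  lra.
elim: n => [|n IH]; first by rewrite big_ord0 le_max lexx.
rewrite big_ord_recr /= -natr1; move: IH; set S := \sum_(i < n) _.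
rewrite !le_max ler_norml.
case: (leP K (x + (n%:R + 1) - 1)) => hS; case: (leP K (x + n%:R - 1)) => hn;
  case: (boolP (- K <= x + n%:R <= K)) => [/andP[h1 h2]|_] /= /orP[h|h];
  apply/orP; try (by left; lra); right; lra.
Qed.

End BinomialAverage.

(** * Splitting sums over finite functions by the first value *)

Definition ffun_cons (T : finType) m (b : T) (f : {ffun 'I_m -> T}) :
    {ffun 'I_m.+1 -> T} :=
  [ffun i => if unlift ord0 i is Some j then f j else b].

Lemma ffun_cons0 (T : finType) m (b : T) (f : {ffun 'I_m -> T}) :
  ffun_cons b f ord0 = b.
Proof. by rewrite ffunE unlift_none. Qed.

Lemma ffun_cons_lift (T : finType) m (b : T) (f : {ffun 'I_m -> T}) j :
  ffun_cons b f (lift ord0 j) = f j.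
Proof. by rewrite ffunE liftK. Qed.

Lemma sum_ffun_cons (V : nmodType) (T : finType) m
    (G : {ffun 'I_m.+1 -> T} -> V) :
  \sum_f G f = \sum_b \sum_f G (ffun_cons b f).
Proof.
rewrite pair_big /= (reindex (fun u => ffun_cons u.1 u.2)) //=.
exists (fun f : {ffun 'I_m.+1 -> T} => (f ord0, [ffun j => f (lift ord0 j)])).
  move=> [b f] _ /=; rewrite ffun_cons0; congr pair.
  by apply/ffunP => j; rewrite ffunE ffun_cons_lift.
move=> f _ /=; apply/ffunP => i; rewrite ffunE.
by case: unliftP => [j ->|->] //; rewrite ffunE.
Qed.

(** * Anti-concentration of a signed sum of Bernoulli bits *)

Section RowConcentration.
Variables (R : realFieldType) (p : R).
Hypothesis p01 : 0 <= p <= 1.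

Definition bernw (b : bool) : R := if b then p else 1 - p.

Lemma bernw_ge0 b : 0 <= bernw b.
Proof. by case: b => /=; move: p01 => /andP[? ?]; lra. Qed.

Lemma sum_bernw : \sum_b bernw b = 1.
Proof. by rewrite big_bool /=; ring. Qed.

(** Expectation of F (x + \sum_j tau_j X_j) for independent Bernoulli(p) bits X_j, as a finite sum
    over bit strings. *)
Definition signed_expect m (tau : 'I_m -> R) (F : R -> R) (x : R) : R :=
  \sum_(f : {ffun 'I_m -> bool})
    (\prod_j bernw (f j)) * F (x + \sum_j tau j * (f j)%:R).

Lemma signed_expect0 (tau : 'I_0 -> R) F x : signed_expect tau F x = F x.
Proof.
rewrite /signed_expect (big_pred1 [ffun=> true]) ?big_ord0 ?mul1r ?addr0 //.
by move=> f; apply/esym/eqP/ffunP => -[].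
Qed.

Lemma signed_expectS m (tau : 'I_m.+1 -> R) F x :
  signed_expect tau F x =
  p * signed_expect (fun j => tau (lift ord0 j)) F (x + tau ord0) +
  (1 - p) * signed_expect (fun j => tau (lift ord0 j)) F x.
Proof.
rewrite {1}/signed_expect sum_ffun_cons big_bool /=; congr (_ + _);
  rewrite mulr_sumr; apply: eq_bigr => f _; rewrite !big_ord_recl !ffun_cons0.
- rewrite mulr1 addrA mulrA; congr (_ * _ * F (_ + _));
    by apply: eq_bigr => j _; rewrite ffun_cons_lift.
- rewrite mulr0 add0r mulrA; congr (_ * _ * F (_ + _));
    by apply: eq_bigr => j _; rewrite ffun_cons_lift.
Qed.

Lemma signed_expect_half m (tau : 'I_m -> R) (F G : R -> R) x :
  (forall y, G y = (F y + F (y + 1)) / 2) ->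
  signed_expect tau G x = (signed_expect tau F x + signed_expect tau F (x + 1)) / 2.
Proof.
move=> FG; rewrite /signed_expect -big_split mulr_suml; apply: eq_bigr => f _ /=.
by rewrite FG [x + 1 + _]addrAC; ring.
Qed.

(* bernw b = q + bernw b ^+ 2 with q = p - p ^+ 2: with probability 2 q the bit is
   fair. By the recursion on F, a fair bit turns F N into F N.+1, up to a
   translation when its sign is -1. *)
Lemma signed_expect_le_binavg (F : nat -> R -> R) (g : nat -> R) m (tau : 'I_m -> R) N x :
  (forall n y, F n.+1 y = (F n y + F n (y + 1)) / 2) ->
  (forall n y, F n y <= g n) ->
  (forall j, tau j = -1 \/ tau j = 1) ->
  signed_expect tau (F N) x <= binavg (2 * (p - p ^+ 2)) (fun i => g (N + i)%N) m.
Proof.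
move=> FS Fg; elim: m tau N x => [|m IH] tau N x htau.
  by rewrite signed_expect0 binavg0 addn0.
rewrite signed_expectS binavgS; set t := fun j => tau (lift ord0 j).
have ht j : t j = -1 \/ t j = 1 by exact: htau.
set B0 := binavg _ (fun i => g (N + i)%N) m.
set B1 := binavg _ _ m.
have e0 y : signed_expect t (F N) y <= B0 by exact: IH.
have e1 y : signed_expect t (F N.+1) y <= B1.
  rewrite /B1; have := IH t N.+1 y ht; congr (_ <= binavg _ _ _).
  by apply/funext => i; rewrite addSnnS.
have fair : (signed_expect t (F N) x + signed_expect t (F N) (x + tau ord0)) / 2 <= B1.
  case: (htau ord0) => ->.
    have := e1 (x - 1); rewrite (@signed_expect_half _ _ (F N)) // subrK; lra.
  by have := e1 x; rewrite (@signed_expect_half _ _ (F N)).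
have := e0 x; have := e0 (x + tau ord0).
move: fair; set u := signed_expect t _ x; set v := signed_expect t _ _ => fair hv hu.
have h0 : 0 <= p ^+ 2 by exact: sqr_ge0.
have h1 : 0 <= (1 - p) ^+ 2 by exact: sqr_ge0.
have h2 : 0 <= p - p ^+ 2.
  by move: p01 => /andP[? ?]; rewrite -[X in X - _]mulr1 expr2 -mulrBr mulr_ge0;
     lra.
rewrite -subr_ge0.
have -> : 2 * (p - p ^+ 2) * B1 + (1 - 2 * (p - p ^+ 2)) * B0
          - (p * v + (1 - p) * u) =
   (p - p ^+ 2) * 2 * (B1 - (u + v) / 2) + p ^+ 2 * (B0 - v)
     + (1 - p) ^+ 2 * (B0 - u) by field.
apply: addr_ge0; last by apply: mulr_ge0 => //; rewrite subr_ge0.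
apply: addr_ge0; last by apply: mulr_ge0 => //; rewrite subr_ge0.
by apply: mulr_ge0; [exact: mulr_ge0 | rewrite subr_ge0].
Qed.

Lemma signed_expect_interval_le (s K : R) m (tau : 'I_m -> R) x :
  0 < s -> 0 <= K -> s ^+ 2 <= m%:R * (p - p ^+ 2) ->
  (forall j, tau j = -1 \/ tau j = 1) ->
  signed_expect tau (fun y => (`|y| <= K)%R%:R) x <= (2 * K + 1) * (3 / (4 * s)).
Proof.
move=> s0 K0 hs htau.
(* [F n y] is the probability that y plus n fair bits lands in [-K, K]. *)
pose F n y : R := binavg 2^-1 (fun i => (`|y + i%:R| <= K)%R%:R) n.
pose g n : R := (s / n.+1%:R + s^-1) / 2 * (2 * K + 1).
have FS n y : F n.+1 y = (F n y + F n (y + 1)) / 2.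
  rewrite /F binavgS.
  under [in LHS]eq_fun => i do rewrite -natr1 [i%:R + 1]addrC addrA.
  by field.
have Fg n y : F n y <= g n.
  apply: le_trans (binavg_half_le _ s0 _) _ => // ; rewrite ler_wpM2l //.
    by rewrite divr_ge0 // addr_ge0 ?invr_ge0 ?divr_ge0 ?ler0n // ltW.
  exact: count_translates_le.
have := @signed_expect_le_binavg F g m tau 0 x FS Fg htau.
have -> : F 0%N = fun y => (`|y| <= K)%R%:R.
  by apply/funext => y; rewrite /F binavg0 addr0.
move/le_trans; apply.
set r := 2 * (p - p ^+ 2).
have r0 : 0 <= r.
  by rewrite mulr_ge0 // -[X in X - _]mulr1 expr2 -mulrBr mulr_ge0;
     move: p01 => /andP[? ?]; lra.
have r1 : r <= 1.
  by rewrite /r -subr_ge0; have := sqr_ge0 (1 - 2 * p); have := sqr_ge0 p; nra.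
have hinv := @binavg_inv _ r m (introT andP (conj r0 r1)).
have -> : (fun i => g (0 + i)%N) =
    (fun i => ((2 * K + 1) * s / 2) * (i.+1%:R)^-1 + (2 * K + 1) / (2 * s) * 1).
  apply/funext => i; rewrite /g add0n.
  have i0 : i.+1%:R != 0 :> R by rewrite pnatr_eq0.
  move: i0; move: (i.+1%:R) => a a0; field; by rewrite a0 gt_eqF.
rewrite binavg_lin binavg_cst.
set b := binavg _ _ _ in hinv *.
(* [hinv] gives b <= 1 / ((m+1) r), and s^2 <= m q with r = 2 q. The two terms of the average then
   contribute (2K+1) / (4s) and (2K+1) / (2s). *)
have hb : b <= (2 * s ^+ 2)^-1.
  have s20 : 0 < s ^+ 2 by rewrite exprn_gt0.
  have b0 : 0 <= b.
    by apply: sumr_ge0 => i _; rewrite !mulr_ge0 ?exprn_ge0 ?subr_ge0.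
  rewrite -[leRHS]mul1r ler_pdivlMr ?mulr_gt0 //; apply: le_trans hinv.
  rewrite mulrC ler_wpM2r // -natr1; move: r0 hs; rewrite /r; lra.
have -> : (2 * K + 1) * (3 / (4 * s)) =
  (2 * K + 1) * s / 2 * (2 * s ^+ 2)^-1 + (2 * K + 1) / (2 * s) * 1.
  by field; rewrite gt_eqF.
by rewrite lerD2r ler_wpM2l // !mulr_ge0 ?addr_ge0 ?mulr_ge0 // ltW.
Qed.

End RowConcentration.

Lemma ler_mx_norm_coord (R : realType) m n (A : 'M[R]_(m, n)) i j :
  `|A i j| <= `|A|.
Proof.
by rewrite [leRHS]/Num.Def.normr /= mx_normrE; apply: (le_bigmax _ _ (i, j)).
Qed.

(** * Union bound for weighted 0/1 matrices *)

Section MatrixWeight.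
Variables (R : realFieldType) (p : R).
Hypothesis p01 : 0 <= p <= 1.

(** Matrices are encoded as functions from rows to bit strings, so that sums of products over rows
    factor by [bigA_distr_bigA]. *)
Definition matw m n (y : {ffun 'I_m -> {ffun 'I_n -> bool}}) : R :=
  \prod_i \prod_j bernw p (y i j).

Lemma matw_ge0 m n (y : {ffun 'I_m -> {ffun 'I_n -> bool}}) : 0 <= matw y.
Proof. by do 2 (apply: prodr_ge0 => ? _); exact: bernw_ge0. Qed.

Lemma sum_matw m n : \sum_(y : {ffun 'I_m -> {ffun 'I_n -> bool}}) matw y = 1.
Proof.
rewrite -(bigA_distr_bigA (fun _ (f : {ffun 'I_n -> bool}) => \prod_j bernw p (f j))).
apply: big1 => i _; rewrite -(bigA_distr_bigA (fun _ b => bernw p b)).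
by apply: big1 => j _; exact: sum_bernw.
Qed.

(* Union bound over the 2 ^ k sign patterns of the last k columns; given the
   pattern, the rows are independent. *)
Lemma sum_matw_success_le m l k (K Q : R)
    (v : {ffun 'I_m -> {ffun 'I_l -> bool}} -> 'I_m -> R)
    (good : {ffun 'I_m -> {ffun 'I_l -> bool}} ->
            {ffun 'I_m -> {ffun 'I_k -> bool}} -> bool) :
  (forall y z, good y z -> exists e : {ffun 'I_k -> bool},
     forall i, `|v y i + \sum_j (-1) ^+ e j * (z i j)%:R| <= K) ->
  (forall (tau : 'I_k -> R) x, (forall j, tau j = -1 \/ tau j = 1) ->
     signed_expect p tau (fun y => (`|y| <= K)%R%:R) x <= Q) ->
  \sum_y \sum_z matw y * matw z * (good y z)%:R <= 2 ^+ k * Q ^+ m.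
Proof.
move=> hgood hQ; rewrite -[leRHS]mul1r -[X in _ <= X * _](@sum_matw m l) mulr_suml.
apply: ler_sum => y _; under eq_bigr do rewrite -mulrA.
rewrite -mulr_sumr ler_wpM2l ?matw_ge0 //.
have -> : 2 ^+ k * Q ^+ m = \sum_(e : {ffun 'I_k -> bool}) Q ^+ m.
  by rewrite sumr_const card_ffun card_bool card_ord -[RHS]mulr_natl natrX.
pose ind (e : {ffun 'I_k -> bool}) i (f : {ffun 'I_k -> bool}) : R :=
  (`|v y i + \sum_j (-1) ^+ e j * (f j)%:R| <= K)%R%:R.
(* When [good y z] holds, the term of its witness [e] already equals 1. *)
apply: (@le_trans _ _ (\sum_e \sum_z matw z * \prod_i ind e i (z i))).
  rewrite exchange_big; apply: ler_sum => z _ /=.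
  rewrite -mulr_sumr ler_wpM2l ?matw_ge0 //.
  have ind0 e : 0 <= \prod_i ind e i (z i) by apply: prodr_ge0 => i _; exact: ler0n.
  case: (boolP (good y z)) => [/hgood[e he]|_]; last exact: sumr_ge0.
  rewrite (bigD1 e) //= -[leLHS]addr0 lerD ?sumr_ge0 //.
  by rewrite big1 // => i _; rewrite /ind he.
apply: ler_sum => e _; rewrite /matw; under eq_bigr do rewrite -big_split /=.
rewrite -(bigA_distr_bigA (fun i (f : {ffun 'I_k -> bool}) =>
  (\prod_j bernw p (f j)) * ind e i f)).
rewrite -[in leRHS](card_ord m) -prodr_const; apply: ler_prod => i _.
apply/andP; split.
  apply: sumr_ge0 => f _; rewrite mulr_ge0 ?ler0n ?prodr_ge0 // => j _.
  exact: bernw_ge0.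
apply: (hQ (fun j => (-1) ^+ e j)) => j.
by case: (e j); [left|right]; rewrite ?expr1 ?expr0.
Qed.

End MatrixWeight.

(** * From the probability space to finite sums over matrices *)

Section Success.
Context (R : realType) (d : measure_display) (T : measurableType d).
Variables (P : probability T R) (m l k : nat) (p : R).
Hypothesis p01 : 0 <= p <= 1.
Variable X : 'I_m * 'I_(l + k) -> {RV P >-> bool}.
Hypothesis hX : iid_bernoulli p X.

Definition cell (y : {ffun 'I_m -> {ffun 'I_l -> bool}})
    (z : {ffun 'I_m -> {ffun 'I_k -> bool}}) (ij : 'I_m * 'I_(l + k)) : bool :=
  match fintype.split ij.2 with inl a => y ij.1 a | inr b => z ij.1 b end.

Definition cell_mx y z : 'M[R]_(m, l + k) := \matrix_(i, j) (cell y z (i, j))%:R.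

Lemma cell_lshift y z i j : cell y z (i, lshift k j) = y i j.
Proof. by rewrite /cell /= -[lshift k j]/(unsplit (inl j)) unsplitK. Qed.

Lemma cell_rshift y z i j : cell y z (i, rshift l j) = z i j.
Proof. by rewrite /cell /= -[rshift l j]/(unsplit (inr j)) unsplitK. Qed.

Definition matrix_atom y z : set T := [set w | forall ij, X ij w = cell y z ij].

Lemma zero_one_matrix_atom y z w : matrix_atom y z w -> zero_one_matrix X w = cell_mx y z.
Proof. by move=> h; apply/matrixP => i j; rewrite !mxE h. Qed.

Lemma measurable_atom y z : measurable (matrix_atom y z).
Proof.
have -> : matrix_atom y z = \big[setI/setT]_ij (X ij @^-1` [set cell y z ij]).
  rewrite -bigcap_seq; apply/seteqP; split=> w /= h ij; first by move=> _; exact: h.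
  by have := h ij; rewrite /= mem_index_enum; apply.
by apply: bigsetI_measurable => ij _; exact: measurable_funPTI.
Qed.

(** Independence is applied to the full index set; each row product then splits at column [l]. *)
Lemma prob_atom y z : P (matrix_atom y z) = (matw p y * matw p z)%:E.
Proof.
case: hX => hdist hind.
have -> : matrix_atom y z =
    [set w | forall ij, ij \in [set: 'I_m * 'I_(l + k)]%SET ->
       [set cell y z ij] (X ij w)].
  by apply/seteqP; split=> w h ij; [move=> _; exact: h|apply: h; rewrite inE].
rewrite (hind _ (fun ij => [set cell y z ij])) //.
have hp ij : P (X ij @^-1` [set cell y z ij]) = (bernw p (cell y z ij))%:E.
  have -> : P (X ij @^-1` [set cell y z ij]) =
      distribution P (X ij) [set cell y z ij] by [].
  rewrite hdist bernoulli_probE // !diracE !in_set1 /bernw.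
  by case: (cell y z ij); rewrite /= ?mule1 ?mule0 ?adde0 ?add0e.
under eq_bigr do rewrite hp.
rewrite big_set /= prodEFin.
rewrite -(pair_big xpredT xpredT (fun i j => bernw p (cell y z (i, j)))) /=.
rewrite /matw -big_split /=; congr (_%:E); apply: eq_bigr => i _.
rewrite big_split_ord /=; congr (_ * _); apply: eq_bigr => j _.
  by rewrite cell_lshift.
by rewrite cell_rshift.
Qed.

Lemma measure_bigsetU_le (I : Type) (r : seq I) (D : pred I) (F : I -> set T) :
  (forall i, measurable (F i)) ->
  (P (\big[setU/set0]_(i <- r | D i) F i) <= \sum_(i <- r | D i) P (F i))%E.
Proof.
move=> mF; elim: r => [|i r IH]; first by rewrite !big_nil measure0.
rewrite !big_cons; case: (D i) => //.
apply: (@le_trans _ _ (P (F i) + P (\big[setU/set0]_(j <- r | D j) F j))%E).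
  by apply: measureU2 => //; exact: bigsetU_measurable.
exact: leeD2l.
Qed.

(** Success is a finite union of atoms, so subadditivity leads to [sum_matw_success_le]. The online
    property makes the contribution of the first [l] columns a function of [y] alone. *)
Lemma prob_success_le (A : 'M[R]_(m, l + k) -> 'cV[R]_(l + k)) (K Q : R) :
  (forall Z, Sigma (A Z)) -> online A ->
  (forall (tau : 'I_k -> R) x, (forall j, tau j = -1 \/ tau j = 1) ->
     signed_expect p tau (fun y => (`|y| <= K)%R%:R) x <= Q) ->
  (P [set w | (`|zero_one_matrix X w *m A (zero_one_matrix X w)| <= K)%R]
     <= (2 ^+ k * Q ^+ m)%:E)%E.
Proof.
move=> sA [f hf] hQ.
pose good y z := `|cell_mx y z *m A (cell_mx y z)| <= K.
have -> : [set w | (`|zero_one_matrix X w *m A (zero_one_matrix X w)| <= K)%R] =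
    \big[setU/set0]_(yz | good yz.1 yz.2) matrix_atom yz.1 yz.2.
  rewrite -bigcup_seq_cond; apply/seteqP; split=> w /=.
    pose y : {ffun 'I_m -> {ffun 'I_l -> bool}} :=
      [ffun i => [ffun j => X (i, lshift k j) w]].
    pose z : {ffun 'I_m -> {ffun 'I_k -> bool}} :=
      [ffun i => [ffun j => X (i, rshift l j) w]].
    have yzw : matrix_atom y z w.
      move=> [i j]; rewrite -(splitK j); case: (fintype.split j) => a /=.
        by rewrite cell_lshift !ffunE.
      by rewrite cell_rshift !ffunE.
    rewrite (zero_one_matrix_atom yzw) => h.
    by exists (y, z) => //=; rewrite mem_index_enum.
  by move=> [[y z] /andP[_ h]] /= yzw; rewrite (zero_one_matrix_atom yzw).
apply: le_trans (measure_bigsetU_le _ _ _) _.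
  by move=> yz; exact: measurable_atom.
under eq_bigr do rewrite prob_atom.
rewrite sumEFin lee_fin big_mkcond /=.
(* An arbitrary filler block: the first [l] signs do not see the last [k] columns. *)
pose z0 : {ffun 'I_m -> {ffun 'I_k -> bool}} := [ffun=> [ffun=> false]].
pose v y i := \sum_j A (cell_mx y z0) (lshift k j) 0 * (y i j)%:R.
have := @sum_matw_success_le R p p01 m l k K Q v good _ hQ.
rewrite pair_big /=.
under eq_bigr => yz _ do rewrite mulr_natr mulrb.
apply=> y z; rewrite /good => hK.
exists [ffun j => A (cell_mx y z) (rshift l j) 0 == -1] => i.
have := le_trans (ler_mx_norm_coord _ i 0) hK.
rewrite mxE big_split_ord /=; congr (is_true (`| _ + _ | <= _)).
  apply: eq_bigr => j _; rewrite mxE cell_lshift mulrC; congr (_ * _).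
  rewrite !hf; congr f; apply/funext => s; apply/matrixP => a b; rewrite !mxE.
  (* Columns revealed at step j have index s <= j < l, hence lie in the block shared by both
     matrices. *)
  have sl : (s < l)%N := leq_trans (ltn_ord s) (ltn_ord j).
  have -> : widen_ord (ltn_ord (lshift k j)) s = lshift k (Ordinal sl).
    exact: val_inj.
  by rewrite !cell_lshift.
apply: eq_bigr => j _; rewrite mxE cell_rshift mulrC ffunE; congr (_ * _).
case: (sA (cell_mx y z) (rshift l j)) => ->; first by rewrite eqxx expr1.
by rewrite gt_eqF ?expr0 //; lra.
Qed.

End Success.

(** * The threshold and the comparison of exponential rates *)

Theorem theorem2p5 (R : realType) (c : R) (hc : c < 2^-1) :
  exists M0 : nat,
    forall (M n : nat) (p : R),
      0 < p < 1 -> (M <= n)%N -> M0%:R <= (p - p ^+ 2) * M%:R ->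
    forall (d : measure_display) (T : measurableType d) (P : probability T R)
      (X : 'I_M * 'I_n -> {RV P >-> bool}),
      iid_bernoulli p X ->
    ~ exists A : 'M[R]_(M, n) -> 'cV[R]_n,
        online_for_discrepancy P (zero_one_matrix X)
          (expR (- (c * M%:R))) (Num.sqrt (M%:R * (p - p ^+ 2)) / 24%:R) A.
Proof.
(* 100 is chosen to force s >= 10; [hQ] below reduces to s / 4 + 3 <= s, that is, s >= 4. *)
exists 100%N => M n p /andP[p0 p1] Mn.
have [l ->] : exists l, n = (l + M)%N by exists (n - M)%N; rewrite subnK.
move=> hM d T P X hX [A [sA hP onA]].
have p01 : 0 <= p <= 1 by rewrite !ltW.
set v := M%:R * (p - p ^+ 2) in hP; set s := Num.sqrt v in hP.
have hv : 100 <= v by rewrite /v mulrC.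
have s10 : 10 <= s.
  have -> : 10 = Num.sqrt (10 ^+ 2) :> R by rewrite sqrtr_sqr ger0_norm.
  by rewrite ler_wsqrtr //; lra.
have s0 : 0 < s by lra.
(* Comparing M-th powers strictly through their bases requires a positive exponent. *)
have M0 : (0 < M)%N.
  by rewrite lt0n; apply: contraTneq hv => M0; rewrite /v M0 mul0r -ltNge.
have hs : s ^+ 2 <= M%:R * (p - p ^+ 2) by rewrite sqr_sqrtr //; lra.
have hQ (tau : 'I_M -> R) x : (forall j, tau j = -1 \/ tau j = 1) ->
    signed_expect p tau (fun y => (`|y| <= s / 24)%R%:R) x <= 4^-1.
  move=> /(signed_expect_interval_le p01 x s0 _ hs) h.
  apply: le_trans (h (s / 24) _) _; first by rewrite divr_ge0 // ltW.
  have -> : (2 * (s / 24) + 1) * (3 / (4 * s)) = (3 * s / 12 + 3) / (4 * s).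
    by field; rewrite gt_eqF.
  by rewrite ler_pdivrMr ?mulr_gt0 //; lra.
have := le_trans hP (prob_success_le p01 hX sA onA hQ).
rewrite lee_fin -exprMn; apply/negP; rewrite -ltNge.
rewrite -mulNr expRM_natr ltr_pXn2r ?nnegrE ?expR_ge0 //.
apply: (@lt_le_trans _ _ (1 - c)); first lra.
by rewrite expR_ge1Dx.
Qed.
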